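(* Let $\Gamma$ be an ADE Dynkin diagram with $n$ vertices, let $W$ be its Coxeter group with Coxeter number $h$, and let $V=V_\Gamma$ be the standard geometric representation of $W$. Let $M=M_\Gamma=\mathrm{Span}_{\mathbb Z}\{\alpha_1,\dots,\alpha_n\}\subset V$ be the $\mathbb Z_+$-module over the Verlinde fusion ring $R_{h-1}$ on which $\Delta_1$ acts by the adjacency matrix of $\Gamma$, restricted to a $\mathbb Z_+$-module over the even part $R_{h-1}^{\mathrm{even}}$. Then the subspace of fixed points of the hypergroup $R_{h-1}^{\mathrm{even}}\otimes_{\mathbb Z}\mathbb R$ acting on $V=M\otimes_{\mathbb Z}\mathbb R$ is the Coxeter plane of $W$.
   Context: **ADE diagrams.** The ADE Dynkin diagrams are the following simple graphs, with vertex sets $\Gamma_0=\{1,\dots,n\}$ ordered as indicated: $A_n$ ($n\ge 1$): the path $n - (n-1) - \cdots - 2 - 1$; $D_n$ ($n\ge 4$): the path $n-(n-1)-\cdots-4-2$ with the two further vertices $1$ and $3$ each joined to $2$; $E_6$: the path $5-4-3-2-1$ with vertex $6$ joined to $3$; $E_7$: the path $6-5-4-3-2-1$ with vertex $7$ joined to $4$; $E_8$: the path $7-6-5-4-3-2-1$ with vertex $8$ joined to $5$. With $d_\Gamma$ the graph distance, set $\Gamma_0^+=\{i : d_\Gamma(i,1)\text{ even}\}$ and $\Gamma_0^-=\{i: d_\Gamma(i,1)\text{ odd}\}$; $\Gamma$ is bipartite with respect to $\Gamma_0=\Gamma_0^+\sqcup\Gamma_0^-$. **Coxeter group and geometric representation.**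 Put $m(i,i)=1$, $m(i,j)=3$ if $i,j$ are adjacent and $m(i,j)=2$ otherwise. The Coxeter group is $W=\langle s_1,\dots,s_n\mid (s_is_j)^{m(i,j)}=e\rangle$ (finite and irreducible). Its Coxeter number $h$ is the common order of all Coxeter elements (products of all the $s_i$, each exactly once, in any order). The distinguished Coxeter element is $\gamma=\gamma^+\gamma^-$ with $\gamma^\pm=\prod_{k\in\Gamma_0^\pm}s_k$. Let $V_\Gamma=\mathrm{Span}_{\mathbb R}\{\alpha_1,\dots,\alpha_n\}$ (with basis the $\alpha_i$), with bilinear form $\langle\alpha_i\mid\alpha_j\rangle=-2\cos(\pi/m(i,j))$; $W$ acts on $V_\Gamma$ by $s_i(v)=v-\langle\alpha_i\mid v\rangle\alpha_i$ (the standard geometric representation). The Cartan matrix is $\mathfrak A=(\langle\alpha_i\mid\alpha_j\rangle)_{i,j}$; $2I_n-\mathfrak A$ is the adjacency matrix of $\Gamma$, viewed as acting on $V_\Gamma$. **Coxeter plane.** It is known that $\pm2\cos(\pi/h)$ are simple eigenvalues of $2I_n-\mathfrak A$, with eigenvectors $u^\pm\in V_\Gamma$, and that $\gamma$ acts on $\mathrm{Span}_{\mathbb R}\{u^+,u^-\}$ by a rotation of order $h$. The Coxeter plane is $\mathrm{Span}_{\mathbb R}\{u^+,u^-\}$. (In the degenerate rank-one case $A_1$, $h=2$, both eigenvalues equal $0$ and this span is all of the one-dimensional space $V_\Gamma$.) **Fusion rings and $\mathbb Z_+$-modules.** $\mathbb Z_+$ denotes the non-negative integers. A fusion ring is a unital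 associative ring $R$ with a fixed finite $\mathbb Z$-basis $B=\{b_i\}_{i\in I}$ containing the unit $1=b_0$, such that $b_ib_j=\sum_kc_{ij}^kb_k$ with $c_{ij}^k\in\mathbb Z_+$, together with an involution $b_i\mapsto b_i^*$ of $B$ extending to an anti-automorphism of $R$, with $c_{ij}^0=1$ if $b_i=b_j^*$ and $c_{ij}^0=0$ otherwise. A fusion subring is a subring that is a fusion ring with basis a subset of $B$. The Frobenius–Perron dimension $\mathrm{FP}:R\to\mathbb R$ is the unique ring homomorphism with $\mathrm{FP}(b_i)>0$ for all $i$ (equivalently, $\mathrm{FP}(b_i)$ is the maximal eigenvalue of left multiplication by $b_i$). A $\mathbb Z_+$-module over $R$ is a left $R$-module $M$ with a fixed $\mathbb Z$-basis $\{m_\ell\}$ such that each $b_i\cdot m_\ell$ is a $\mathbb Z_+$-combination of basis elements. **Verlinde fusion rings.** Let $\Delta_0=1$, $\Delta_1=x$, $\Delta_k=x\Delta_{k-1}-\Delta_{k-2}$ in $\mathbb Z[x]$. The Verlinde fusion ring is $R_N=\mathbb Z[x]/(\Delta_N(x))$ with basis $\{\Delta_k\}_{0\le k\le N-1}$ and identity involution. Its even part $R_N^{\mathrm{even}}=\mathrm{Span}_{\mathbb Z}\{\Delta_{2k}\mid 0\le k\le\lfloor (N-1)/2\rfloor\}$ is a fusion subring. The $\mathbb Z_+$-module $M_\Gamma$ over $R_{h-1}$ has basis $\{\alpha_1,\dots,\alpha_n\}$ and is given by the ring homomorphism $R_{h-1}\to\mathrm{End}_{\mathbb Z}(M_\Gamma)$,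 $\Delta_1\mapsto 2I_n-\mathfrak A$; it is known that this is well defined and makes $M_\Gamma$ an irreducible $\mathbb Z_+$-module over $R_{h-1}$ (i.e. no proper non-empty subset of the basis spans a submodule). **Hypergroups.** A (finite) hypergroup $\mathbb R[K]$ is a unital associative $\mathbb R$-algebra with a fixed finite basis $K=\{r_i\}_{i\in I}$, with $r_ir_j=\sum_k N_{ij}^kr_k$, such that: some $r_0\in K$ is the unit; $N_{ij}^k\ge0$; $\sum_kN_{ij}^k=1$; and there is an involution $i\mapsto i^*$ of $I$ extending to an anti-automorphism of $\mathbb R[K]$ such that $N_{ij}^0=N_{ji}^0$, and $N_{ij}^0>0$ if and only if $j=i^*$. For a fusion ring $R$ with basis $\{b_i\}$, $R\otimes_{\mathbb Z}\mathbb R$ is a hypergroup with basis $\{b_i/\mathrm{FP}(b_i)\}$ and involution $b_i/\mathrm{FP}(b_i)\mapsto b_i^*/\mathrm{FP}(b_i)$. An action of $\mathbb R[K]$ on $V\cong\mathbb R^n$ is a (unital) $\mathbb R$-algebra homomorphism $\Theta:\mathbb R[K]\to\mathrm{Mat}_n(\mathbb R)$; a fixed point is $x\in V$ with $\Theta(r_i)x=x$ for all $i\in I$. The action of $R_{h-1}^{\mathrm{even}}\otimes_{\mathbb Z}\mathbb R$ on $M\otimes_{\mathbb Z}\mathbb R=V$ is the one obtained from the module $M$ by extension of scalars. *)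

(* Defs.v *)
From HB Require Import structures.
From mathcomp Require Import all_boot all_order all_algebra.
From mathcomp Require Import boolp reals trigo.
From mathcomp Require Import zify ring lra.

Set Implicit Arguments.
Unset Strict Implicit.
Unset Printing Implicit Defensive.

Import Order.TTheory GRing.Theory Num.Theory.
Local Open Scope ring_scope.

Inductive dynkin := TypeA of nat | TypeD of nat | TypeE6 | TypeE7 | TypeE8.

Definition is_ADE (G : dynkin) : bool :=
  match G with TypeA n => (1 <= n)%N | TypeD n => (4 <= n)%N | _ => true end.

Definition rank (G : dynkin) : nat :=
  match G with
  | TypeA n => n | TypeD n => n | TypeE6 => 6 | TypeE7 => 7 | TypeE8 => 8
  end.

(* Edges between vertex labels 1, ..., n, each listed in one orientation. *)
Definition dynkin_edge (G : dynkin) (a b : nat) : bool :=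
  match G with
  | TypeA _ => b == a.+1
  | TypeD _ => (a == 2) && (b \in [:: 1; 3; 4]) || (4 <= a) && (b == a.+1)
  | TypeE6 => (b == a.+1) && (b <= 5) || (a == 3) && (b == 6)
  | TypeE7 => (b == a.+1) && (b <= 6) || (a == 4) && (b == 7)
  | TypeE8 => (b == a.+1) && (b <= 7) || (a == 5) && (b == 8)
  end%N.

(* The ordinal i stands for the vertex labelled i + 1. *)
Definition adjacent (G : dynkin) (i j : 'I_(rank G)) : bool :=
  dynkin_edge G i.+1 j.+1 || dynkin_edge G j.+1 i.+1.

Definition coxeter_m (G : dynkin) (i j : 'I_(rank G)) : nat :=
  if i == j then 1 else if adjacent i j then 3 else 2.

Section CoxeterGroup.
Variable G : dynkin.
Local Notation word := (seq 'I_(rank G)).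

(* The congruence on words generated by (s_i s_j)^m(i,j) = e. As m(i,i) = 1,
   each s_i is its own inverse, so the monoid thus presented is the group with
   the same presentation. *)
Inductive coxeter_rel : word -> word -> Prop :=
| CoxRelator i j : coxeter_rel (flatten (nseq (coxeter_m i j) [:: i; j])) [::]
| CoxRefl u : coxeter_rel u u
| CoxSym u v : coxeter_rel u v -> coxeter_rel v u
| CoxTrans u v w : coxeter_rel u v -> coxeter_rel v w -> coxeter_rel u w
| CoxCat u v u' v' :
    coxeter_rel u v -> coxeter_rel u' v' -> coxeter_rel (u ++ u') (v ++ v').

Definition coxeter_relb (u v : word) : bool := `[< coxeter_rel u v >].

Lemma coxeter_relb_equiv : equiv_class_of coxeter_relb.
Proof.
split=> [u|u v|v u w].
- by apply/asboolP; exact: CoxRefl.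
- by apply/asboolP/asboolP; exact: CoxSym.
- by move=> /asboolP uv /asboolP vw; apply/asboolP; exact: CoxTrans uv vw.
Qed.

Canonical coxeter_equiv := EquivRelPack coxeter_relb_equiv.

Definition coxeter_group : Type := {eq_quot coxeter_equiv}%qT.
HB.instance Definition _ := Choice.on coxeter_group.

Definition cox_class (u : word) : coxeter_group :=
  (\pi_({eq_quot coxeter_equiv}) u)%qT.
Definition cox_word (x : coxeter_group) : word :=
  (repr (x : {eq_quot coxeter_equiv}))%qT.

Lemma cox_classP u v : cox_class u = cox_class v <-> coxeter_rel u v.
Proof.
rewrite /cox_class; split=> [/eqP|uv].
  by rewrite eqmodE => /asboolP.
by apply/eqP; rewrite eqmodE; apply/asboolP.
Qed.

Lemma cox_wordK x : cox_class (cox_word x) = x.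
Proof. exact: reprK. Qed.

Lemma cox_word_class u : coxeter_rel (cox_word (cox_class u)) u.
Proof. by apply/cox_classP; rewrite cox_wordK. Qed.

Definition cox_mul x y := cox_class (cox_word x ++ cox_word y).
Definition cox_inv x := cox_class (rev (cox_word x)).

Lemma cox_mulE u v : cox_mul (cox_class u) (cox_class v) = cox_class (u ++ v).
Proof. by apply/cox_classP; apply: CoxCat; exact: cox_word_class. Qed.

Lemma coxeter_rel_rev u : coxeter_rel (u ++ rev u) [::].
Proof.
elim/last_ind: u => [|u i IHu]; first exact: CoxRefl.
rewrite rev_rcons -cats1 -catA /=.
apply: CoxTrans IHu; apply: CoxCat (CoxRefl _) _.
rewrite -cat1s -[i :: rev u]cat1s catA -[X in coxeter_rel _ X]cat0s.
apply: CoxCat (CoxRefl _).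
by have := CoxRelator i i; rewrite /coxeter_m eqxx.
Qed.

Lemma cox_mulA : associative cox_mul.
Proof.
move=> x y z; rewrite -(cox_wordK x) -(cox_wordK y) -(cox_wordK z).
by rewrite !cox_mulE catA.
Qed.

Lemma cox_mul1 : left_id (cox_class [::]) cox_mul.
Proof. by move=> x; rewrite -(cox_wordK x) cox_mulE. Qed.

Lemma cox_1mul : right_id (cox_class [::]) cox_mul.
Proof. by move=> x; rewrite -(cox_wordK x) cox_mulE cats0. Qed.

Lemma cox_mulV : right_inverse (cox_class [::]) cox_inv cox_mul.
Proof.
move=> x; rewrite /cox_inv -{1}(cox_wordK x) cox_mulE.
by apply/cox_classP; exact: coxeter_rel_rev.
Qed.

Lemma cox_Vmul : left_inverse (cox_class [::]) cox_inv cox_mul.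
Proof.
move=> x; rewrite /cox_inv -{2}(cox_wordK x) cox_mulE.
apply/cox_classP; rewrite -{2}[cox_word x]revK; exact: coxeter_rel_rev.
Qed.

HB.instance Definition _ := isGroup.Build coxeter_group
  cox_mulA cox_mul1 cox_1mul cox_Vmul cox_mulV.

Definition cox_gen (i : 'I_(rank G)) : coxeter_group := cox_class [:: i].

End CoxeterGroup.

Definition is_coxeter_element (G : dynkin) (c : coxeter_group G) : Prop :=
  exists2 s : seq 'I_(rank G),
    perm_eq s (enum 'I_(rank G)) & c = (\prod_(i <- s) cox_gen i)%g.

Definition has_order (gT : groupType) (x : gT) (h : nat) : Prop :=
  [/\ (0 < h)%N, (x ^+ h = 1)%g
    & forall k, (0 < k < h)%N -> (x ^+ k <> 1)%g].

Definition is_coxeter_number (G : dynkin) (h : nat) : Prop :=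
  forall c : coxeter_group G, is_coxeter_element c -> has_order c h.

Record fusionRing := FusionRing {
  fr_ring :> pzRingType;
  fr_idx : finType;
  fr_b : fr_idx -> fr_ring;
  fr_coord : fr_ring -> fr_idx -> int;
  fr_coordK : forall x, \sum_i fr_b i *~ fr_coord x i = x;
  fr_coord_sum : forall (a : fr_idx -> int) j,
    fr_coord (\sum_i fr_b i *~ a i) j = a j;
  fr_one : fr_idx;
  fr_b_one : fr_b fr_one = 1;
  fr_c : fr_idx -> fr_idx -> fr_idx -> nat;
  fr_mul : forall i j, fr_b i * fr_b j = \sum_k fr_b k *+ fr_c i j k;
  fr_star : fr_idx -> fr_idx;
  fr_starK : involutive fr_star;
  (* (b_i b_j)^* = b_j^* b_i^* *)
  fr_star_anti : forall i j k,
    fr_c (fr_star j) (fr_star i) (fr_star k) = fr_c i j k;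
  fr_c_one : forall i j, fr_c i j fr_one = (i == fr_star j)
}.

Arguments fr_b : clear implicits.
Arguments fr_coord : clear implicits.
Arguments fr_one : clear implicits.
Arguments fr_c : clear implicits.
Arguments fr_star : clear implicits.

Section FusionRingTheory.
Variable F : fusionRing.
Local Notation I := (fr_idx F).
Local Notation b := (fr_b F).
Local Notation c := (fr_c F).
Local Notation coord := (fr_coord F).

Lemma fr_coord_inj x y : coord x =1 coord y -> x = y.
Proof.
by move=> e; rewrite -(fr_coordK x) -(fr_coordK y); apply: eq_bigr => i _; rewrite e.
Qed.

Lemma fr_coordD x y i : coord (x + y) i = coord x i + coord y i.
Proof.
rewrite -{1}(fr_coordK x) -{1}(fr_coordK y) -big_split /=.
under eq_bigr do rewrite -mulrzDr.
exact: (fr_coord_sum (fun i => coord x i + coord y i)).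
Qed.

Lemma fr_coordN x i : coord (- x) i = - coord x i.
Proof.
rewrite -{1}(fr_coordK x) -sumrN.
under eq_bigr do rewrite -mulrNz.
exact: (fr_coord_sum (fun i => - coord x i)).
Qed.

Lemma fr_coordB x y i : coord (x - y) i = coord x i - coord y i.
Proof. by rewrite fr_coordD fr_coordN. Qed.

Lemma fr_coord_b i j : coord (b i) j = (i == j).
Proof.
have -> : b i = \sum_k b k *~ (i == k).
  rewrite (bigD1 i) //= eqxx mulr1z big1 ?addr0 // => k ki.
  by rewrite eq_sym (negPf ki) mulr0z.
exact: (fr_coord_sum (fun k => (i == k) : int)).
Qed.

Lemma fr_coord0 j : coord 0 j = 0.
Proof. by rewrite -(subrr 0) fr_coordB subrr. Qed.

Lemma fr_coord_big (J : Type) (r : seq J) (P : pred J) (f : J -> F) i :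
  coord (\sum_(k <- r | P k) f k) i = \sum_(k <- r | P k) coord (f k) i.
Proof.
apply: (big_morph (fun x => coord x i)) => [x y|]; first exact: fr_coordD.
exact: fr_coord0.
Qed.

Lemma fr_coordMz x n i : coord (x *~ n) i = coord x i * n.
Proof.
rewrite -{1}(fr_coordK x) mulrz_suml.
under eq_bigr do rewrite -mulrzA.
exact: (fr_coord_sum (fun i => coord x i * n)).
Qed.

Lemma fr_coordM x y k :
  coord (x * y) k = \sum_i \sum_j coord x i * coord y j * (c i j k)%:R.
Proof.
rewrite -{1}(fr_coordK x) -{1}(fr_coordK y) mulr_suml fr_coord_big.
apply: eq_bigr => i _; rewrite mulr_sumr fr_coord_big; apply: eq_bigr => j _.
rewrite mulrzAl mulrzAr -mulrzA fr_coordMz mulrC [in LHS](mulrC (coord y j)).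
congr (_ * _).
rewrite fr_mul fr_coord_big (bigD1 k) //= big1 => [|l lk].
  by rewrite pmulrn fr_coordMz fr_coord_b eqxx mul1r addr0 natz.
by rewrite pmulrn fr_coordMz fr_coord_b (negPf lk) mul0r.
Qed.

Lemma fr_coord_bM i j k : coord (b i * b j) k = (c i j k)%:R.
Proof.
rewrite fr_coordM (bigD1 i) //= [X in _ + X]big1 ?addr0 => [|i' ii'].
  rewrite (bigD1 j) //= big1 ?addr0 => [|j' jj'].
    by rewrite !fr_coord_b !eqxx !mul1r.
  by rewrite !fr_coord_b [j == _]eq_sym (negPf jj') mulr0 mul0r.
rewrite big1 // => j' _.
by rewrite fr_coord_b eq_sym (negPf ii') !mul0r.
Qed.

Lemma fr_cA i j l m :
  (\sum_k c i j k * c k l m = \sum_k c j l k * c i k m)%N.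
Proof.
have Z (J : finType) (f : J -> F) (g : J -> nat) :
  coord (\sum_k f k *+ g k) m = \sum_k coord (f k) m * (g k)%:R.
  by rewrite fr_coord_big; apply: eq_bigr => k _; rewrite pmulrn fr_coordMz natz.
apply/eqP; rewrite -(eqr_nat int) !natr_sum; apply/eqP.
have := congr1 (fun x => coord x m) (mulrA (b i) (b j) (b l)).
rewrite !fr_mul mulr_sumr mulr_suml.
rewrite (eq_bigr (fun k => b i * b k *+ c j l k)) => [|k _]; last by rewrite mulrnAr.
rewrite [X in _ = coord X _ -> _](eq_bigr (fun k => b k * b l *+ c i j k)) => [|k _]; last by rewrite mulrnAl.
rewrite !Z => e; rewrite (eq_bigr _ (fun k _ => natrM _ _ _)).
rewrite [RHS](eq_bigr _ (fun k _ => natrM _ _ _)).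
under eq_bigr do rewrite mulrC -fr_coord_bM.
under [RHS]eq_bigr do rewrite mulrC -fr_coord_bM.
by rewrite -e.
Qed.

Lemma fr_c1l j k : c (fr_one F) j k = (j == k).
Proof.
apply/eqP; rewrite -(eqr_nat int) -fr_coord_bM fr_b_one mul1r fr_coord_b.
by rewrite natz.
Qed.

Lemma fr_c1r j k : c j (fr_one F) k = (j == k).
Proof.
apply/eqP; rewrite -(eqr_nat int) -fr_coord_bM fr_b_one mulr1 fr_coord_b.
by rewrite natz.
Qed.

(* Frobenius reciprocity. *)
Lemma fr_c_rot i j k : c i j (fr_star F k) = c j k (fr_star F i).
Proof.
have := fr_cA i j k (fr_one F).
rewrite (bigD1 (fr_star F k)) //= big1 ?addn0 => [|l lk]; last first.
  by rewrite fr_c_one (negPf lk) muln0.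
rewrite fr_c_one eqxx muln1 => ->.
rewrite (bigD1 (fr_star F i)) //= big1 ?addn0 => [|l li]; last first.
  by rewrite fr_c_one -(inj_eq (inv_inj (@fr_starK F))) fr_starK eq_sym (negPf li) muln0.
by rewrite fr_c_one fr_starK eqxx muln1.
Qed.

Lemma fr_c_star i j k : c (fr_star F i) k j = c i j k.
Proof.
by rewrite -(fr_star_anti i j k) fr_c_rot fr_starK.
Qed.

End FusionRingTheory.

Record subbasis (F : fusionRing) := SubBasis {
  sb_set :> {set fr_idx F};
  sb_one : fr_one F \in sb_set;
  sb_star : forall i, i \in sb_set -> fr_star F i \in sb_set;
  sb_mul : forall i j k, i \in sb_set -> j \in sb_set ->
    fr_c F i j k != 0%N -> k \in sb_set
}.

Section FusionSubring.
Variables (F : fusionRing) (J : subbasis F).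

Definition in_subring : {pred F} :=
  fun x => [forall i, (i \notin J) ==> (fr_coord F x i == 0)].

Lemma in_subringP x :
  reflect (forall i, i \notin J -> fr_coord F x i = 0) (x \in in_subring).
Proof.
apply: (iffP forallP) => [h i iJ|h i].
  by have := h i; rewrite iJ => /eqP.
by apply/implyP => /h ->.
Qed.

Lemma in_subring_b i : i \in J -> fr_b F i \in in_subring.
Proof.
move=> iJ; apply/in_subringP => j; rewrite fr_coord_b.
by case: eqP => // <-; rewrite iJ.
Qed.

Lemma in_subring_closed : subring_closed in_subring.
Proof.
split=> [|x y /in_subringP hx /in_subringP hy|x y /in_subringP hx /in_subringP hy].
- by rewrite -fr_b_one; apply: in_subring_b; exact: sb_one.
- by apply/in_subringP => i iJ; rewrite fr_coordB hx // hy // subrr.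
apply/in_subringP => k kJ; rewrite fr_coordM big1 // => i _.
rewrite big1 // => j _.
have [iJ|/hx->] := boolP (i \in J); last by rewrite !mul0r.
have [jJ|/hy->] := boolP (j \in J); last by rewrite mulr0 mul0r.
have [->|c0] := eqVneq (fr_c F i j k) 0%N; first by rewrite mulr0.
by rewrite (sb_mul iJ jJ c0) in kJ.
Qed.

HB.instance Definition _ :=
  GRing.isSubringClosed.Build F in_subring in_subring_closed.

Definition subring_carrier : Type := {x : F | x \in in_subring}.
HB.instance Definition _ := SubChoice.on subring_carrier.
HB.instance Definition _ := GRing.SubChoice_isSubPzRing.Build F _
  subring_carrier in_subring_closed.

Definition subring_incl : subring_carrier -> F := val.
HB.instance Definition _ := GRing.RMorphism.on subring_incl.

Definition sub_idx : finType := {i : fr_idx F | i \in J}.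
Definition sub_b (i : sub_idx) : subring_carrier :=
  exist _ (fr_b F (val i)) (in_subring_b (valP i)).
Definition sub_coord (x : subring_carrier) (i : sub_idx) : int :=
  fr_coord F (val x) (val i).
Definition sub_one : sub_idx := exist _ (fr_one F) (sb_one J).
Definition sub_c (i j k : sub_idx) : nat := fr_c F (val i) (val j) (val k).
Definition sub_star (i : sub_idx) : sub_idx :=
  exist _ (fr_star F (val i)) (sb_star (valP i)).

Lemma big_sub_idx (V : nmodType) (f : fr_idx F -> V) :
  (forall i, i \notin J -> f i = 0) -> \sum_(i : sub_idx) f (val i) = \sum_i f i.
Proof.
move=> f0; rewrite [RHS](bigID (mem J)) /= [X in _ = _ + X]big1 ?addr0 => [|i /f0 //].
by rewrite (big_sub (mem J)).
Qed.

Lemma sub_coordK x : \sum_i sub_b i *~ sub_coord x i = x.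
Proof.
apply: val_inj; rewrite /= -[RHS]fr_coordK.
have -> : (sval (\sum_i sub_b i *~ sub_coord x i) : F) =
    subring_incl (\sum_i sub_b i *~ sub_coord x i) by [].
rewrite raddf_sum.
under eq_bigr do rewrite raddfMz.
rewrite (big_sub_idx (f := fun i => fr_b F i *~ fr_coord F (val x) i)) // => i iJ.
by case: x => x /= /in_subringP ->.
Qed.

Lemma sub_coord_sum (a : sub_idx -> int) j :
  sub_coord (\sum_i sub_b i *~ a i) j = a j.
Proof.
rewrite /sub_coord.
have -> : (val (\sum_i sub_b i *~ a i) : F) =
    subring_incl (\sum_i sub_b i *~ a i) by [].
rewrite raddf_sum fr_coord_big (bigD1 j) //= big1 => [|i ij].
  by rewrite raddfMz fr_coordMz fr_coord_b eqxx mul1r addr0.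
by rewrite raddfMz fr_coordMz fr_coord_b (inj_eq val_inj) (negPf ij) mul0r.
Qed.

Lemma sub_mul i j : sub_b i * sub_b j = \sum_k sub_b k *+ sub_c i j k.
Proof.
apply: val_inj; rewrite /= fr_mul.
have -> : (sval (\sum_k sub_b k *+ sub_c i j k) : F) =
    subring_incl (\sum_k sub_b k *+ sub_c i j k) by [].
rewrite raddf_sum; under [RHS]eq_bigr do rewrite raddfMn.
rewrite (big_sub_idx (f := fun k => fr_b F k *+ fr_c F (val i) (val j) k)) //.
move=> k kJ; have [->|c0] := eqVneq (fr_c F (val i) (val j) k) 0%N; first by [].
by rewrite (sb_mul (valP i) (valP j) c0) in kJ.
Qed.

Lemma sub_b_one : sub_b sub_one = 1.
Proof. by apply: val_inj; rewrite /= fr_b_one. Qed.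

Lemma sub_starK : involutive sub_star.
Proof. by move=> i; apply: val_inj; rewrite /= fr_starK. Qed.

Lemma sub_star_anti i j k :
  sub_c (sub_star j) (sub_star i) (sub_star k) = sub_c i j k.
Proof. exact: fr_star_anti. Qed.

Lemma sub_c_one i j : sub_c i j sub_one = (i == sub_star j).
Proof. by rewrite /sub_c fr_c_one. Qed.

Definition fusion_subring : fusionRing :=
  FusionRing sub_coordK sub_coord_sum sub_b_one sub_mul sub_starK
    sub_star_anti sub_c_one.

End FusionSubring.

Record FPdim (F : fusionRing) (R : realType) := MkFPdim {
  FP_mor :> {rmorphism F -> R};
  FP_gt0 : forall i, 0 < FP_mor (fr_b F i)
}.

(* A module with a basis indexed by 'I_n is given by the matrices of the ring
   action on that basis, acting on column vectors. *)
Record ZplusModule (F : fusionRing) (n : nat) := MkZplusModule {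
  zm_act :> {rmorphism F -> 'M[int]_n};
  zm_ge0 : forall i k l, 0 <= zm_act (fr_b F i) k l
}.

Section RestrictModule.
Variables (F : fusionRing) (J : subbasis F) (n : nat) (M : ZplusModule F n).

Definition restrict_act : fusion_subring J -> 'M[int]_n :=
  fun x => M (subring_incl x).

Fact restrict_act_additive : zmod_morphism restrict_act.
Proof. by move=> x y; rewrite /restrict_act !rmorphB. Qed.
Fact restrict_act_monoid : monoid_morphism restrict_act.
Proof. by split=> [|x y]; rewrite /restrict_act ?rmorph1 ?rmorphM. Qed.
HB.instance Definition _ := GRing.isZmodMorphism.Build _ _ restrict_act
  restrict_act_additive.
HB.instance Definition _ := GRing.isMonoidMorphism.Build _ _ restrict_act
  restrict_act_monoid.

Lemma restrict_act_ge0 i k l : 0 <= restrict_act (fr_b (fusion_subring J) i) k l.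
Proof. exact: zm_ge0. Qed.

Definition restrict_module : ZplusModule (fusion_subring J) n :=
  @MkZplusModule (fusion_subring J) n restrict_act restrict_act_ge0.

End RestrictModule.

Section FPTheory.
Variables (F : fusionRing) (R : realType) (FP : FPdim F R).
Local Notation d i := (FP (fr_b F i)).

Lemma FP_mul i j : d i * d j = \sum_k (fr_c F i j k)%:R * d k.
Proof.
rewrite -rmorphM fr_mul raddf_sum; apply: eq_bigr => k _.
by rewrite raddfMn /= mulr_natl.
Qed.

Lemma FP_star i : d (fr_star F i) = d i.
Proof.
pose S := \sum_k d k * d k.
have S0 : 0 < S.
  rewrite /S (bigD1 (fr_one F)) //= ltr_wpDr ?mulr_gt0 ?FP_gt0 //.
  by apply: sumr_ge0 => k _; rewrite mulr_ge0 // ltW ?FP_gt0.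
apply: (mulIf (lt0r_neq0 S0)); rewrite /S !mulr_sumr.
under eq_bigr do rewrite mulrA FP_mul mulr_suml.
under [RHS]eq_bigr do rewrite mulrA FP_mul mulr_suml.
rewrite exchange_big; apply: eq_bigr => k _; apply: eq_bigr => j _ /=.
by rewrite fr_c_star mulrAC.
Qed.

End FPTheory.

Record hypergroup (R : realType) := Hypergroup {
  hg_alg :> algType R;
  hg_idx : finType;
  hg_r : hg_idx -> hg_alg;
  hg_basis : forall x, exists! a : {ffun hg_idx -> R}, x = \sum_i a i *: hg_r i;
  hg_N : hg_idx -> hg_idx -> hg_idx -> R;
  hg_mul : forall i j, hg_r i * hg_r j = \sum_k hg_N i j k *: hg_r k;
  hg_one : hg_idx;
  hg_r_one : hg_r hg_one = 1;
  hg_N_ge0 : forall i j k, 0 <= hg_N i j k;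
  hg_N_sum : forall i j, \sum_k hg_N i j k = 1;
  hg_star : hg_idx -> hg_idx;
  hg_starK : involutive hg_star;
  (* (r_i r_j)^* = r_j^* r_i^* *)
  hg_star_anti : forall i j k,
    hg_N (hg_star j) (hg_star i) (hg_star k) = hg_N i j k;
  hg_N_sym : forall i j, hg_N i j hg_one = hg_N j i hg_one;
  hg_N_gt0 : forall i j, 0 < hg_N i j hg_one <-> j = hg_star i
}.

Arguments hg_r {R} _ _.

Record hgAction (R : realType) (K : hypergroup R) (n : nat) := HgAction {
  ha_map :> K -> 'M[R]_n;
  ha_linear : linear ha_map;
  ha_monoid : monoid_morphism ha_map
}.

Definition fixed_point (R : realType) (K : hypergroup R) (n : nat)
    (Theta : hgAction K n) (v : 'cV[R]_n) : Prop :=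
  forall i, Theta (hg_r K i) *m v = v.

Section ScalarExtension.
Variables (F : fusionRing) (R : realType).
Local Notation I := (fr_idx F).
Local Notation c := (fr_c F).

(* F (x)_Z R: the coordinates with respect to 1 (x) b_i. *)
Definition scalar_ext : Type := {ffun I -> R^o}.
HB.instance Definition _ := GRing.Lmodule.copy scalar_ext {ffun I -> R^o}.

Definition ext_b (i : I) : scalar_ext := [ffun j => (i == j)%:R].
Definition ext_one : scalar_ext := ext_b (fr_one F).
Definition ext_mul (x y : scalar_ext) : scalar_ext :=
  [ffun k => \sum_i \sum_j x i * y j * (c i j k)%:R].

Lemma ext_decomp (x : scalar_ext) : x = \sum_i x i *: ext_b i.
Proof.
apply/ffunP => j; rewrite sum_ffunE (bigD1 j) //= big1 ?addr0 => [|i ij].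
  by rewrite !ffunE eqxx; exact/esym/mulr1.
by rewrite !ffunE (negPf ij); exact: mulr0.
Qed.

Lemma ext_mulDl : left_distributive ext_mul +%R.
Proof.
move=> x y z; apply/ffunP => k; rewrite !ffunE -big_split.
apply: eq_bigr => i _; rewrite -big_split; apply: eq_bigr => j _ /=.
by rewrite ffunE !mulrDl.
Qed.

Lemma ext_mulDr : right_distributive ext_mul +%R.
Proof.
move=> x y z; apply/ffunP => k; rewrite !ffunE -big_split.
apply: eq_bigr => i _; rewrite -big_split; apply: eq_bigr => j _ /=.
by rewrite ffunE mulrDr mulrDl.
Qed.

Lemma ext_scaleAl (a : R) x y : a *: ext_mul x y = ext_mul (a *: x) y.
Proof.
apply/ffunP => k; rewrite !ffunE scaler_sumr; apply: eq_bigr => i _.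
rewrite scaler_sumr; apply: eq_bigr => j _; rewrite ffunE.
by rewrite /GRing.scale /= !mulrA.
Qed.

Lemma ext_scaleAr (a : R) x y : a *: ext_mul x y = ext_mul x (a *: y).
Proof.
apply/ffunP => k; rewrite !ffunE scaler_sumr; apply: eq_bigr => i _.
rewrite scaler_sumr; apply: eq_bigr => j _; rewrite ffunE.
by rewrite /GRing.scale /= !mulrA [a * _]mulrC.
Qed.

Lemma ext_mul_b i j k : ext_mul (ext_b i) (ext_b j) k = (c i j k)%:R.
Proof.
rewrite ffunE (bigD1 i) //= [X in _ + X]big1 ?addr0 => [|i' ii'].
  rewrite (bigD1 j) //= big1 ?addr0 => [|j' jj'].
    by rewrite !ffunE !eqxx !mul1r.
  by rewrite !ffunE [j == _]eq_sym (negPf jj') mulr0 mul0r.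
by rewrite big1 // => j' _; rewrite ffunE eq_sym (negPf ii') !mul0r.
Qed.

Lemma ext_mul_sumr x (J : Type) (r : seq J) (f : J -> scalar_ext) :
  ext_mul x (\sum_(i <- r) f i) = \sum_(i <- r) ext_mul x (f i).
Proof.
apply: big_morph => [y z|]; first exact: ext_mulDr.
by have := ext_scaleAr 0 x 0; rewrite !scale0r.
Qed.

Lemma ext_mul_suml x (J : Type) (r : seq J) (f : J -> scalar_ext) :
  ext_mul (\sum_(i <- r) f i) x = \sum_(i <- r) ext_mul (f i) x.
Proof.
apply: (big_morph (ext_mul^~ x)) => [y z|]; first exact: ext_mulDl.
by have := ext_scaleAl 0 0 x; rewrite !scale0r.
Qed.

Lemma ext_mul_bE i j :
  ext_mul (ext_b i) (ext_b j) = \sum_k (c i j k)%:R *: ext_b k.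
Proof. by rewrite [LHS]ext_decomp; under eq_bigr do rewrite ext_mul_b. Qed.

Lemma ext_mulA : associative ext_mul.
Proof.
have A i j l : ext_mul (ext_b i) (ext_mul (ext_b j) (ext_b l)) =
    ext_mul (ext_mul (ext_b i) (ext_b j)) (ext_b l).
  rewrite !ext_mul_bE ext_mul_sumr ext_mul_suml; apply/ffunP => m.
  rewrite !sum_ffunE.
  rewrite (eq_bigr (fun k => ((c j l k * c i k m)%N)%:R : R)) => [|k _].
    rewrite -natr_sum -fr_cA natr_sum; apply: eq_bigr => k _.
    by rewrite -ext_scaleAl ffunE ext_mul_b natrM.
  by rewrite -ext_scaleAr ffunE ext_mul_b natrM.
move=> x y z.
rewrite (ext_decomp x) !ext_mul_suml; apply: eq_bigr => i _.
rewrite -!ext_scaleAl; congr (_ *: _).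
rewrite (ext_decomp y) ext_mul_suml !ext_mul_sumr ext_mul_suml.
apply: eq_bigr => j _.
rewrite -ext_scaleAr -!ext_scaleAl -ext_scaleAr; congr (_ *: _).
rewrite (ext_decomp z) !ext_mul_sumr; apply: eq_bigr => l _.
by rewrite -!ext_scaleAr A.
Qed.

Lemma ext_mul1 : left_id ext_one ext_mul.
Proof.
move=> x; rewrite {1}(ext_decomp x) ext_mul_sumr [RHS]ext_decomp.
apply: eq_bigr => i _; rewrite -ext_scaleAr; congr (_ *: _).
by apply/ffunP => k; rewrite ext_mul_b fr_c1l ffunE.
Qed.

Lemma ext_1mul : right_id ext_one ext_mul.
Proof.
move=> x; rewrite {1}(ext_decomp x) ext_mul_suml [RHS]ext_decomp.
apply: eq_bigr => i _; rewrite -ext_scaleAl; congr (_ *: _).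
by apply/ffunP => k; rewrite ext_mul_b fr_c1r ffunE.
Qed.

Lemma ext_one_neq0 : ext_one != 0.
Proof.
by apply/eqP => /ffunP/(_ (fr_one F)); rewrite !ffunE eqxx => /eqP; rewrite oner_eq0.
Qed.

HB.instance Definition _ := GRing.Zmodule_isNzRing.Build scalar_ext
  ext_mulA ext_mul1 ext_1mul ext_mulDl ext_mulDr ext_one_neq0.
HB.instance Definition _ := GRing.Lmodule_isLalgebra.Build R scalar_ext ext_scaleAl.
HB.instance Definition _ := GRing.Lalgebra_isAlgebra.Build R scalar_ext ext_scaleAr.

End ScalarExtension.

Section FusionHypergroup.
Variables (F : fusionRing) (R : realType) (FP : FPdim F R).
Local Notation I := (fr_idx F).
Local Notation d i := (FP (fr_b F i)).

Definition fh_r (i : I) : scalar_ext F R := (d i)^-1 *: ext_b R i.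
Definition fh_N (i j k : I) : R := (fr_c F i j k)%:R * d k / (d i * d j).

Let d_gt0 i : 0 < d i. Proof. exact: FP_gt0. Qed.
Let d_neq0 i : d i != 0. Proof. exact: lt0r_neq0. Qed.

Lemma fh_basis x : exists! a : {ffun I -> R}, x = \sum_i a i *: fh_r i.
Proof.
exists [ffun i => x i * d i]; split=> [|a ->].
  rewrite {1}(ext_decomp x); apply: eq_bigr => i _.
  by rewrite ffunE scalerA mulfK.
apply/ffunP => i; rewrite ffunE sum_ffunE (bigD1 i) //= big1 => [|j ji].
  rewrite !ffunE eqxx addr0 /GRing.scale /= mulr1 mulfVK //.
by rewrite !ffunE (negPf ji) /GRing.scale /= !mulr0.
Qed.

Lemma fh_mul i j : fh_r i * fh_r j = \sum_k fh_N i j k *: fh_r k.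
Proof.
rewrite /fh_r -scalerAl -scalerAr scalerA [X in _ *: X]ext_mul_bE scaler_sumr.
apply: eq_bigr => k _; rewrite !scalerA; congr (_ *: _).
by rewrite /fh_N [RHS]mulrAC mulfK // invfM mulrC.
Qed.

Lemma fh_r_one : fh_r (fr_one F) = 1.
Proof. by rewrite /fh_r fr_b_one rmorph1 invr1 scale1r. Qed.

Lemma fh_N_ge0 i j k : 0 <= fh_N i j k.
Proof. by rewrite !mulr_ge0 ?invr_ge0 ?mulr_ge0 ?ler0n // ltW. Qed.

Lemma fh_N_sum i j : \sum_k fh_N i j k = 1.
Proof. by rewrite -mulr_suml -FP_mul divff // mulf_neq0. Qed.

Lemma fh_star_anti i j k :
  fh_N (fr_star F j) (fr_star F i) (fr_star F k) = fh_N i j k.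
Proof. by rewrite /fh_N fr_star_anti !FP_star [d j * d i]mulrC. Qed.

Lemma fh_N_sym i j : fh_N i j (fr_one F) = fh_N j i (fr_one F).
Proof.
rewrite /fh_N !fr_c_one [d j * d i]mulrC; congr (_%:R * _ / _).
by rewrite -(inj_eq (inv_inj (@fr_starK F))) fr_starK eq_sym.
Qed.

Lemma fh_N_gt0 i j : 0 < fh_N i j (fr_one F) <-> j = fr_star F i.
Proof.
rewrite fh_N_sym /fh_N fr_c_one; split=> [|->].
  by case: eqP => // _; rewrite !mul0r ltxx.
by rewrite eqxx mul1r divr_gt0 ?mulr_gt0.
Qed.

Definition fusion_hypergroup : hypergroup R :=
  Hypergroup fh_basis fh_mul fh_r_one fh_N_ge0 fh_N_sum (@fr_starK F)
    fh_star_anti fh_N_sym fh_N_gt0.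

Variables (n : nat) (M : ZplusModule F n).

(* The action of F on M extended R-linearly to M (x)_Z R = R^n. *)
Definition ext_act (x : fusion_hypergroup) : 'M[R]_n :=
  \sum_i (x : scalar_ext F R) i *: map_mx intr (M (fr_b F i)).

Lemma ext_act_linear : linear ext_act.
Proof.
move=> a x y; rewrite /ext_act scaler_sumr -big_split; apply: eq_bigr => i _ /=.
by rewrite !ffunE scalerDl scalerA.
Qed.

Lemma ext_act_b i : ext_act (ext_b R i) = map_mx intr (M (fr_b F i)).
Proof.
rewrite /ext_act (bigD1 i) //= big1 ?addr0 => [|j ji]; first by rewrite ffunE eqxx scale1r.
by rewrite ffunE eq_sym (negPf ji) scale0r.
Qed.

Lemma ext_act_monoid : monoid_morphism ext_act.
Proof.
split=> [|x y].
  by rewrite [1]/(ext_b R (fr_one F)) ext_act_b fr_b_one rmorph1 map_mx1.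
have act_mul i j : map_mx intr (M (fr_b F i)) * map_mx intr (M (fr_b F j)) =
    \sum_k (fr_c F i j k)%:R *: map_mx intr (M (fr_b F k)) :> 'M[R]_n.
  rewrite -[LHS](map_mxM intr) -[_ *m _](rmorphM M) fr_mul raddf_sum.
  rewrite raddf_sum; apply: eq_bigr => k _.
  by rewrite raddfMn /= raddfMn scaler_nat.
pose B i : 'M[R]_n := map_mx intr (M (fr_b F i)).
pose xr i : R := (x : scalar_ext F R) i; pose yr i : R := (y : scalar_ext F R) i.
have -> : ext_act x * ext_act y =
    \sum_i \sum_j \sum_k (xr i * yr j * (fr_c F i j k)%:R) *: B k.
  rewrite [LHS]mulmx_suml; apply: eq_bigr => i _.
  rewrite mulmx_sumr; apply: eq_bigr => j _.
  rewrite -scalemxAl -scalemxAr scalerA [X in _ *: X]act_mul scaler_sumr.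
  by apply: eq_bigr => k _; rewrite scalerA.
under eq_bigr do rewrite exchange_big /=.
rewrite exchange_big; apply: eq_bigr => k _ /=.
rewrite ffunE scaler_suml; apply: eq_bigr => i _.
by rewrite scaler_suml.
Qed.

Definition scalar_ext_action : hgAction fusion_hypergroup n :=
  HgAction ext_act_linear ext_act_monoid.

End FusionHypergroup.

Fixpoint Delta (k : nat) : {poly int} :=
  match k with
  | 0 => 1
  | 1 => 'X
  | (k''.+1 as k').+1 => 'X * Delta k' - Delta k''
  end.

Arguments Delta : simpl never.

Lemma DeltaSS k : Delta k.+2 = 'X * Delta k.+1 - Delta k.
Proof. by []. Qed.

Lemma Delta_size_monic k : (size (Delta k) == k.+1) && (Delta k \is monic).
Proof.
suff: (size (Delta k) == k.+1) && (Delta k \is monic) /\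
  (size (Delta k.+1) == k.+2) && (Delta k.+1 \is monic) by case.
elim: k => [|k [/andP[/eqP s0 m0] /andP[/eqP s1 m1]]].
  by rewrite size_poly1 monic1 size_polyX monicX.
split; first by rewrite s1 eqxx m1.
have sX : size ('X * Delta k.+1) = k.+3.
  by rewrite mulrC size_mulX ?monic_neq0 // s1.
have lt : (size (- Delta k) < size ('X * Delta k.+1)%R)%N.
  by rewrite size_polyN s0 sX.
by rewrite DeltaSS size_polyDl // sX eqxx /= monicE lead_coefDl // -monicE monicMl ?monicX.
Qed.

Lemma size_Delta k : size (Delta k) = k.+1.
Proof. by have /andP[/eqP] := Delta_size_monic k. Qed.

Lemma monic_Delta k : Delta k \is monic.
Proof. by have /andP[] := Delta_size_monic k. Qed.

(* R_0 is the zero ring, which is not a fusion ring; N = 0 is read as N = 1, so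
   that N.-1.+1 = max(N, 1) replaces N throughout. *)
Section Verlinde.
Variable N : nat.
Local Notation m := N.-1.

Definition verlinde_ring := {poly %/ Delta m.+1}.

Lemma mk_monic_Delta : mk_monic (Delta m.+1) = Delta m.+1.
Proof. by rewrite /mk_monic size_Delta monic_Delta. Qed.

Definition vDelta (k : nat) : verlinde_ring := in_qpoly (Delta m.+1) (Delta k).

Lemma vDelta0 : vDelta 0 = 1.
Proof. exact: in_qpoly1. Qed.

Lemma vDeltaN : vDelta m.+1 = 0.
Proof.
apply: val_inj; rewrite /= mk_monic_Delta.
rewrite Pdiv.RingMonic.rmodpp //; exact: (monic_Delta m.+1).
Qed.

Lemma vDeltaSS k : vDelta k.+2 = vDelta 1 * vDelta k.+1 - vDelta k.
Proof. by rewrite /vDelta DeltaSS raddfB /= in_qpolyM. Qed.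

Lemma vDelta_poly k : (k <= m)%N -> vDelta k = Delta k :> {poly int}.
Proof. by move=> km; apply: in_qpoly_small; rewrite mk_monic_Delta !size_Delta !ltnS. Qed.

(* Truncated Clebsch-Gordan rule. *)
Definition verlinde_c (i j k : nat) : nat :=
  [&& ~~ odd (i + j + k), k <= i + j, i <= j + k, j <= i + k
    & i + j + k <= m.*2]%N.

Definition shift (a : nat -> nat) (k : nat) : nat :=
  if k is k'.+1 then a k' else 0.

Lemma vDelta_mulX (a : nat -> nat) : a m.+1 = 0%N ->
  vDelta 1 * (\sum_(k < m.+1) vDelta k *+ a k) =
  \sum_(k < m.+1) vDelta k *+ (shift a k + a k.+1)%N.
Proof.
move=> aN.
have X k : vDelta 1 * vDelta k.+1 = vDelta k.+2 + vDelta k by rewrite vDeltaSS subrK.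
under [RHS]eq_bigr do rewrite mulrnDr.
rewrite big_split /=.
rewrite [X in _ = X + _]big_ord_recl [X in _ = _ + X]big_ord_recr /= aN !mulr0n.
rewrite add0r addr0 mulr_sumr big_ord_recl /= mulrnAr vDelta0 mulr1.
under eq_bigr => k _ do rewrite mulrnAr /bump /= add1n X mulrnDl.
rewrite big_split /= addrA; congr (_ + _).
under [RHS]eq_bigr do rewrite /bump /= add1n.
transitivity (\sum_(k < m.+1) vDelta k.+1 *+ a k).
  by rewrite big_ord_recl.
by rewrite big_ord_recr /= vDeltaN mul0rn addr0.
Qed.

Lemma verlinde_c_rec i j k : (i < m)%N -> (j <= m)%N -> (k <= m)%N ->
  (shift (verlinde_c i j) k + verlinde_c i j k.+1 =
   shift (fun i' => verlinde_c i' j k) i + verlinde_c i.+1 j k)%N.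
Proof. by rewrite /shift /verlinde_c; case: k => [|k]; case: i => [|i]; lia. Qed.

Lemma verlinde_cN i j : (i <= m)%N -> (j <= m)%N -> verlinde_c i j m.+1 = 0%N.
Proof. by rewrite /verlinde_c; lia. Qed.

Lemma vDelta_mul i j : (i <= m)%N -> (j <= m)%N ->
  vDelta i * vDelta j = \sum_(k < m.+1) vDelta k *+ verlinde_c i j k.
Proof.
move=> + jm; pose P i := vDelta i * vDelta j =
  \sum_(k < m.+1) vDelta k *+ verlinde_c i j k.
have P0 : P 0%N.
  rewrite /P vDelta0 mul1r (bigD1 (Ordinal (jm : (j < m.+1)%N))) //= big1 ?addr0.
    by rewrite /verlinde_c; have -> : [&& ~~ odd (0 + j + j), j <= 0 + j, 0 <= j + j, j <= 0 + j
      & 0 + j + j <= m.*2]%N = true by lia.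
  move=> k; rewrite -val_eqE /= => kj.
  by rewrite /verlinde_c; have -> : [&& ~~ odd (0 + j + k), k <= 0 + j, 0 <= j + k, j <= 0 + k
      & 0 + j + k <= m.*2]%N = false by lia.
suff H : forall i, ((i <= m)%N -> P i) /\ ((i.+1 <= m)%N -> P i.+1) by case: (H i).
elim=> [|k [IH0 IH1]].
  split=> // im; rewrite /P -[vDelta j]mul1r -vDelta0 P0 vDelta_mulX ?verlinde_cN //.
  by apply: eq_bigr => l _; rewrite verlinde_c_rec // -ltnS.
split=> // km; rewrite /P vDeltaSS mulrBl -mulrA IH1 ?IH0; [|lia|lia].
rewrite vDelta_mulX ?verlinde_cN //; last lia.
apply/eqP; rewrite subr_eq -big_split /=; apply/eqP; apply: eq_bigr => l _.
by rewrite -mulrnDr verlinde_c_rec ?[(_ + verlinde_c k j l)%N]addnC // -ltnS.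
Qed.

Definition Delta_mx : 'M[int]_m.+1 := \matrix_(i, j) (Delta i)`_j.

Lemma Delta_mx_unit : Delta_mx \in unitmx.
Proof.
rewrite unitmxE det_trig.
  rewrite big1 ?unitr1 // => i _; rewrite mxE.
  by have /monicP := monic_Delta i; rewrite lead_coefE size_Delta.
apply/is_trig_mxP => i j ij; rewrite mxE nth_default // size_Delta //.
Qed.

Definition verlinde_coord (x : verlinde_ring) (i : 'I_m.+1) : int :=
  (poly_rV (x : {poly int}) *m invmx Delta_mx) 0 i.

Lemma poly_rV_sum (a : 'I_m.+1 -> int) :
  poly_rV ((\sum_(i < m.+1) vDelta i *~ a i : verlinde_ring) : {poly int}) =
  (\row_i a i) *m Delta_mx.
Proof.
apply/rowP => j; rewrite !mxE raddf_sum coef_sum; apply: eq_bigr => i _.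
rewrite !mxE raddfMz.
have {1}<- : vDelta i = Delta i :> {poly int} by rewrite vDelta_poly // -ltnS.
by rewrite coefMrz mulrC mulrzz.
Qed.

Lemma verlinde_coord_sum (a : 'I_m.+1 -> int) j :
  verlinde_coord (\sum_(i < m.+1) vDelta i *~ a i) j = a j.
Proof. by rewrite /verlinde_coord poly_rV_sum mulmxK ?Delta_mx_unit // mxE. Qed.

Lemma verlinde_coordK x : \sum_(i < m.+1) vDelta i *~ verlinde_coord x i = x.
Proof.
have sz (y : verlinde_ring) : (size (y : {poly int}) <= m.+1)%N.
  have h : size (mk_monic (Delta m.+1)) = m.+2 by rewrite mk_monic_Delta size_Delta.
  by rewrite -ltnS -h; exact: size_mk_monic.
apply: val_inj => /=.
rewrite -[LHS](poly_rV_K (sz _)) -[RHS](poly_rV_K (sz _)) poly_rV_sum.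
congr rVpoly; rewrite -[RHS](mulmxKV Delta_mx_unit); congr (_ *m _).
by apply/rowP => i; rewrite mxE.
Qed.

Lemma verlinde_c_one (i j : 'I_m.+1) : verlinde_c i j (ord0 : 'I_m.+1) = (i == j).
Proof.
by rewrite /verlinde_c -val_eqE; case: i j => [i ?] [j ?] /=; lia.
Qed.

Lemma verlinde_mul (i j : 'I_m.+1) :
  vDelta i * vDelta j = \sum_(k : 'I_m.+1) vDelta k *+ verlinde_c i j k.
Proof. by apply: vDelta_mul; rewrite -ltnS ltn_ord. Qed.

Lemma verlinde_c_sym (i j k : 'I_m.+1) : verlinde_c j i k = verlinde_c i j k.
Proof. by rewrite /verlinde_c; case: i j k => [i ?] [j ?] [k ?] /=; lia. Qed.

Definition verlinde : fusionRing :=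
  @FusionRing verlinde_ring 'I_m.+1 (fun k => vDelta k) verlinde_coord
    verlinde_coordK verlinde_coord_sum ord0 vDelta0
    (fun i j k => verlinde_c i j k) verlinde_mul id (fun _ => erefl)
    verlinde_c_sym verlinde_c_one.

Definition even_idx : {set fr_idx verlinde} := [set i : 'I_m.+1 | ~~ odd i].

Lemma even_one : fr_one verlinde \in even_idx.
Proof. by rewrite inE. Qed.

Lemma even_star i : i \in even_idx -> fr_star verlinde i \in even_idx.
Proof. by []. Qed.

Lemma even_mul i j k : i \in even_idx -> j \in even_idx ->
  fr_c verlinde i j k != 0%N -> k \in even_idx.
Proof.
by rewrite !inE /= /verlinde_c !oddD => /negPf -> /negPf ->; case: (odd k).
Qed.

Definition verlinde_even : subbasis verlinde :=
  SubBasis even_one even_star even_mul.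

End Verlinde.

Definition adjacency_mx (G : dynkin) : 'M[int]_(rank G) :=
  \matrix_(i, j) (adjacent i j)%:R.

Definition cartan_mx (R : realType) (G : dynkin) : 'M[R]_(rank G) :=
  \matrix_(i, j) (- 2 * cos (pi / (coxeter_m i j)%:R)).

Definition is_eigenvector (R : realType) (n : nat) (A : 'M[R]_n) (a : R)
    (u : 'cV[R]_n) : Prop :=
  u != 0 /\ A *m u = a *: u.

(* V_Gamma is the space of column vectors, alpha_i being the i-th basis vector. *)
Definition is_coxeter_plane (R : realType) (G : dynkin) (h : nat)
    (P : {vspace 'cV[R]_(rank G)}) : Prop :=
  exists up um : 'cV[R]_(rank G),
    [/\ is_eigenvector (2%:M - cartan_mx R G) (2 * cos (pi / h%:R)) up,
        is_eigenvector (2%:M - cartan_mx R G) (- (2 * cos (pi / h%:R))) um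
      & P = <<[:: up; um]>>%VS].

Lemma cos_pi3 (R : realType) : cos (pi / 3) = 1 / 2 :> R.
Proof.
set x : R := pi / 3; have x3 : x + x + x = pi by rewrite /x; lra.
have c0 : 0 < cos x.
  apply: cos_gt0_pihalf; have := pi_gt0 R; rewrite /x => p0.
  by apply/andP; split; lra.
have := cospi R; rewrite -x3 !cosD !sinD.
have s2 : sin x * sin x = 1 - cos x * cos x.
  by have := cos2Dsin2 x; rewrite !expr2 => <-; ring.
move=> e; have : (cos x + 1) * (2 * cos x - 1) ^+ 2 = 0.
  have -> : 0 = (cos x * cos x - sin x * sin x) * cos x -
     (sin x * cos x + cos x * sin x) * sin x + 1 :> R by rewrite e; ring.
  have -> : (sin x * cos x + cos x * sin x) * sin x = 2 * cos x * (sin x * sin x) by ring.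
  by rewrite s2; ring.
move/eqP; rewrite mulf_eq0 sqrf_eq0 => /orP[/eqP|/eqP] h; lra.
Qed.

Lemma adjacency_cartan (R : realType) (G : dynkin) :
  2%:M - cartan_mx R G = map_mx intr (adjacency_mx G).
Proof.
apply/matrixP => i j; rewrite !mxE /coxeter_m.
have [->|ij] := eqVneq i j.
  rewrite divr1 cospi (_ : adjacent j j = false) ?mulr1n.
    by rewrite /= mulrN1 opprK subrr.
  rewrite /adjacent orbb; case: G i j => [n|n|||] i j //=; case: j => j ? /=; rewrite ?inE; lia.
rewrite mulr0n sub0r; case: (adjacent i j); first 
  by rewrite cos_pi3 mul1r mulNr divff ?pnatr_eq0 // opprK.
by rewrite cos_pihalf mulr0 oppr0.
Qed.

(* Main.v *)
(** With A the adjacency matrix and lambda = 2 cos(pi/h), Delta_k acts on V as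
    Delta_k(A), and Delta_k(lambda) = sin((k+1)pi/h)/sin(pi/h) is positive for
    k <= h-2; since positive characters of a fusion ring are unique,
    FP(Delta_2k) = Delta_2k(lambda).  Hence v is fixed iff
    Delta_2k(A) v = Delta_2k(lambda) v for all k, which amounts to
    A^2 v = lambda^2 v.  The matrix sum_k Delta_k(lambda) Delta_k(A) is
    nonnegative and its columns are lambda-eigenvectors of A by the
    Christoffel-Darboux identity, so lambda is a simple eigenvalue by a
    Perron-Frobenius argument on the connected graph; the 2-colouring of the
    graph turns this into the simplicity of -lambda. *)
Require Import Defs.
From mathcomp Require Import all_boot all_order all_algebra.
From mathcomp Require Import reals trigo.
From mathcomp Require Import zify ring lra.

Set Implicit Arguments.
Unset Strict Implicit.
Unset Printing Implicit Defensive.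

Import Order.TTheory GRing.Theory Num.Theory.
Local Open Scope ring_scope.

(** * Connectedness and bipartiteness of the ADE graphs *)

Section DynkinGraph.
Variable G : dynkin.

Lemma adjacent_sym : symmetric (@adjacent G).
Proof. by move=> i j; rewrite /adjacent orbC. Qed.

Lemma adjacent_smaller (i : 'I_(rank G)) : is_ADE G -> (0 < i)%N ->
  exists2 j : 'I_(rank G), adjacent i j & (j < i)%N.
Proof.
case: G i => [n|n|||] /= [i hi] hG /= i0.
- have lt : (i.-1 < n)%N by lia.
  by exists (Ordinal lt); rewrite /adjacent /=; lia.
(* In 0-based indices the neighbour is the predecessor, except at the label that starts or forms a
   side branch: 4 in D_n, joined to 2, and the last label in E_n, joined to the branch vertex. *)
- have lt : ((if i == 3 then 1 else i.-1) < n)%N by case: ifP; lia.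
  by exists (Ordinal lt); rewrite /adjacent /=; case: ifP; rewrite ?inE; lia.
- have lt : ((if i == 5 then 2 else i.-1) < 6)%N by case: ifP; lia.
  by exists (Ordinal lt); rewrite /adjacent /=; case: ifP; lia.
- have lt : ((if i == 6 then 3 else i.-1) < 7)%N by case: ifP; lia.
  by exists (Ordinal lt); rewrite /adjacent /=; case: ifP; lia.
- have lt : ((if i == 7 then 4 else i.-1) < 8)%N by case: ifP; lia.
  by exists (Ordinal lt); rewrite /adjacent /=; case: ifP; lia.
Qed.

Lemma adjacent_connect (i j : 'I_(rank G)) : is_ADE G ->
  connect (@adjacent G) i j.
Proof.
move=> hG.
have con_sym : connect_sym (@adjacent G).
  exact/sym_connect_sym/adjacent_sym.
have con0 (k l : 'I_(rank G)) : l = 0%N :> nat -> connect (@adjacent G) k l.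
  move=> l0; have [n] := ubnP (k : nat); elim: n k => // n IHn k kn.
  have [k0|k0] := posnP k.
    by have -> : k = l by apply: val_inj; rewrite /= k0 l0.
  have [k' kk' lt] := adjacent_smaller hG k0.
  exact: connect_trans (connect1 kk') (IHn k' (leq_trans lt kn)).
pose z := Ordinal (leq_ltn_trans (leq0n i) (ltn_ord i)).
by apply: connect_trans (con0 i z erefl) _; rewrite con_sym con0.
Qed.

(* The parity of the label, except that the vertices 1, 2, 3 of D_n come
   in the opposite parity to the rest. *)
Definition colour (i : 'I_(rank G)) : bool :=
  odd i (+) (if G is TypeD _ then 3 <= i else false)%N.

Lemma adjacent_colour i j : adjacent i j -> colour j = ~~ colour i.
Proof.
rewrite /colour /adjacent; case: G i j => [n|n|||] [i hi] [j hj] /=; rewrite ?inE; lia.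
Qed.

End DynkinGraph.

(** * Nonnegative eigenvectors of irreducible nonnegative matrices *)

Section PerronFrobenius.
Variables (R : realFieldType) (n : nat) (A : 'M[R]_n) (lam : R).
Hypothesis A_ge0 : forall i j, 0 <= A i j.
Hypothesis A_irr : forall i j, connect [rel i j | 0 < A i j] i j.

(** Where [z] vanishes, the nonnegative terms of that row of [A *m z] sum to 0, so [z] vanishes at
    every out-neighbour, and then along every path. *)
Lemma nonneg_eigenvector_eq0 (z : 'cV[R]_n) i0 : A *m z = lam *: z ->
  (forall i, 0 <= z i 0) -> z i0 0 = 0 -> z = 0.
Proof.
move=> Az z0 zi0.
have step i j : 0 < A i j -> z i 0 = 0 -> z j 0 = 0.
  move=> Aij zi; have /eqP : (A *m z) i 0 = 0 by rewrite Az mxE zi mulr0.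
  rewrite mxE psumr_eq0 => [/allP/(_ j (mem_index_enum _))|k _]; last exact: mulr_ge0.
  by rewrite mulf_eq0 (gt_eqF Aij) => /eqP.
apply/colP => j; rewrite mxE; have /connectP[p + ->] := A_irr i0 j.
elim: p i0 zi0 => //= k p IHp i zi /andP[Aik pth].
exact: IHp (step _ _ Aik zi) pth.
Qed.

Lemma nonneg_eigenvalue_simple (w u v : 'cV[R]_n) :
  w != 0 -> (forall i, 0 <= w i 0) -> A *m w = lam *: w ->
  u != 0 -> A *m u = lam *: u -> A *m v = lam *: v -> exists c, v = c *: u.
Proof.
move=> w0 wge0 Aw u0 Au Av.
have wgt0 i : 0 < w i 0.
  rewrite lt0r wge0 andbT; apply: contra_neq w0 => wi0.
  exact: nonneg_eigenvector_eq0 Aw wge0 wi0.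
have /matrix0Pn[i0 _] := u0.
have colw x : A *m x = lam *: x -> exists c, x = c *: w.
  (* The least ratio c = x_k / w_k makes x - c w a nonnegative eigenvector that vanishes at k, hence
     zero. *)
  move=> Ax; case: (arg_minP (fun i => x i 0 / w i 0) (erefl : xpredT i0)) => k _ kmin.
  exists (x k 0 / w k 0); apply/eqP; rewrite -subr_eq0; apply/eqP.
  apply: (nonneg_eigenvector_eq0 (i0 := k)) => [|i|].
  - by rewrite mulmxBr -scalemxAr Ax Aw scalerBr !scalerA mulrC.
  - by rewrite !mxE subr_ge0 -ler_pdivlMr // kmin.
  - by rewrite !mxE divfK ?subrr // gt_eqF.
have [c uE] := colw _ Au; have [e ->] := colw _ Av.
have c0 : c != 0 by apply: contra_neq u0 => c0; rewrite uE c0 scale0r.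
by exists (e / c); rewrite uE scalerA divfK.
Qed.

End PerronFrobenius.

(** * Real values of the polynomials [Delta k] *)

Section ChebyshevEval.
Variable R : realType.
Implicit Types (x t : R) (k : nat).

(** This is U_k(x/2), with U_k the Chebyshev polynomial of the second kind. *)
Definition cheb x k : R := (map_poly intr (Delta k)).[x].

Lemma cheb0 x : cheb x 0 = 1.
Proof. by rewrite /cheb rmorph1 hornerC. Qed.

Lemma cheb1 x : cheb x 1 = x.
Proof. by rewrite /cheb map_polyX hornerX. Qed.

Lemma chebSS x k : cheb x k.+2 = x * cheb x k.+1 - cheb x k.
Proof. by rewrite /cheb DeltaSS rmorphB rmorphM /= map_polyX !hornerE. Qed.

Lemma chebN x k : cheb (- x) k = (-1) ^+ k * cheb x k.
Proof.
suff: cheb (- x) k = (-1) ^+ k * cheb x k /\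
  cheb (- x) k.+1 = (-1) ^+ k.+1 * cheb x k.+1 by case.
elim: k => [|k [IH0 IH1]]; first by rewrite !cheb0 !cheb1; split; ring.
by split=> //; rewrite !chebSS IH0 IH1 !exprS; ring.
Qed.

Lemma cheb_cos t k : cheb (2 * cos t) k * sin t = sin (t *+ k.+1).
Proof.
suff: cheb (2 * cos t) k * sin t = sin (t *+ k.+1) /\
  cheb (2 * cos t) k.+1 * sin t = sin (t *+ k.+2) by case.
elim: k => [|k [IH0 IH1]].
  by rewrite cheb0 cheb1 [t *+ 2]mulr2n sinD mulr1n; split; ring.
split=> //; rewrite chebSS mulrBl -[_ * _ * sin t]mulrA IH1 IH0.
have -> : t *+ k.+1 = t *+ k.+2 - t by rewrite [t *+ k.+2]mulrSr addrK.
by rewrite [t *+ k.+3]mulrSr; move: (t *+ k.+2) => s; rewrite sinB sinD; ring.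
Qed.

(** The value is sin((k+1)pi/h) / sin(pi/h), and both angles lie strictly between 0 and pi. *)
Lemma cheb_cos_gt0 h k : (k.+1 < h)%N -> 0 < cheb (2 * cos (pi / h%:R)) k.
Proof.
move=> kh; set t := pi / h%:R.
have h0 : 0 < h%:R :> R by rewrite ltr0n; lia.
have sin_gt0 l : (0 < l < h)%N -> 0 < sin (t *+ l).
  move=> /andP[l0 lh]; apply: sin_gt0_pi; rewrite /t -mulr_natr.
  rewrite mulrAC ltr_pdivrMr // ltr_pM2l ?pi_gt0 // ltr_nat lh andbT.
  by rewrite divr_gt0 // mulr_gt0 ?pi_gt0 // ltr0n.
have s0 : 0 < sin t by rewrite -[t]mulr1n sin_gt0 //; lia.
by rewrite -(pmulr_lgt0 _ s0) cheb_cos sin_gt0 //; lia.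
Qed.

End ChebyshevEval.

(** * Uniqueness of positive characters, and fixed points as common eigenvectors *)

Section PositiveCharacters.
Variables (F : fusionRing) (R : realType).
Local Notation I := (fr_idx F).

(** Recording only the values on the basis allows a comparison with [FP] without building a ring
    homomorphism; the value at the unit is 1, being positive and idempotent. *)
Definition positive_character (e : I -> R) : Prop :=
  (forall i, 0 < e i) /\
  (forall i j, e i * e j = \sum_k (fr_c F i j k)%:R * e k).

(** Multiplying S = sum_j d_j e_j by d_i or by e_{i*} gives the same double sum, by the reciprocity
    [fr_c_star]; then S > 0 cancels. *)
Lemma positive_character_star (d e : I -> R) :
  positive_character d -> positive_character e ->
  forall i, d i = e (fr_star F i).
Proof.
move=> [d0 dM] [e0 eM] i.
have S0 : 0 < \sum_j d j * e j.
  rewrite (bigD1 i) //= ltr_wpDr ?mulr_gt0 //.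
  by apply: sumr_ge0 => k _; rewrite mulr_ge0 // ltW.
apply: (mulIf (lt0r_neq0 S0)); rewrite !mulr_sumr.
under eq_bigr do rewrite mulrA dM mulr_suml.
under [RHS]eq_bigr do rewrite mulrCA eM mulr_sumr.
rewrite exchange_big; apply: eq_bigr => k _; apply: eq_bigr => j _ /=.
by rewrite fr_c_star; ring.
Qed.

Lemma positive_character_unique (d e : I -> R) :
  positive_character d -> positive_character e -> d =1 e.
Proof.
move=> dP eP i.
by rewrite (positive_character_star dP eP) -(positive_character_star eP eP).
Qed.

Lemma FP_positive_character (FP : FPdim F R) :
  positive_character (fun i => FP (fr_b F i)).
Proof. by split=> [i|i j]; [exact: FP_gt0 | exact: FP_mul]. Qed.

Lemma eigenvector_character n (M : ZplusModule F n) (e : I -> R) (u : 'cV[R]_n) :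
  u != 0 -> (forall i, map_mx intr (M (fr_b F i)) *m u = e i *: u) ->
  forall i j, e i * e j = \sum_k (fr_c F i j k)%:R * e k.
Proof.
move=> u0 Mu i j.
have : map_mx intr (M (fr_b F i * fr_b F j)) *m u = (e i * e j) *: u.
  by rewrite rmorphM map_mxM -mulmxA Mu -scalemxAr Mu scalerA mulrC.
rewrite fr_mul !raddf_sum mulmx_suml.
under eq_bigr do rewrite !raddfMn /= -scaler_nat -scalemxAl Mu scalerA.
rewrite -scaler_suml => /eqP; rewrite -subr_eq0 -scalerBl scaler_eq0 (negPf u0).
by rewrite orbF subr_eq0 => /eqP.
Qed.

(** The hypergroup basis is b_i / FP(b_i), so fixing v means having eigenvalue FP(b_i) under b_i. *)
Lemma fixed_pointP (FP : FPdim F R) n (M : ZplusModule F n) (v : 'cV[R]_n) :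
  fixed_point (scalar_ext_action FP M) v <->
  forall i, map_mx intr (M (fr_b F i)) *m v = FP (fr_b F i) *: v.
Proof.
have actE i : @ext_act _ _ FP _ M (fh_r FP i) =
    (FP (fr_b F i))^-1 *: map_mx intr (M (fr_b F i)).
  rewrite -(ext_act_b FP M) /ext_act scaler_sumr; apply: eq_bigr => j _.
  by rewrite ffunE scalerA.
split=> fix_v i.
  have := fix_v i; rewrite /= actE -scalemxAl => {2}<-.
  by rewrite scalerA divff ?scale1r // gt_eqF // FP_gt0.
by rewrite /= actE -scalemxAl fix_v scalerA mulVf ?scale1r // gt_eqF // FP_gt0.
Qed.

End PositiveCharacters.

(** * Matrices of the [Delta k] on a module over a Verlinde ring *)

Section VerlindeModule.
Variables (R : realType) (N n : nat) (M : ZplusModule (verlinde N) n).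

Definition Delta_act k : 'M[R]_n := map_mx intr (M (vDelta N k)).
Local Notation X := Delta_act.

Lemma Delta_act0 : X 0 = 1%:M.
Proof. by rewrite /X vDelta0 rmorph1 map_mx1. Qed.

Lemma Delta_actSS k : X k.+2 = X 1 *m X k.+1 - X k.
Proof. by rewrite /X vDeltaSS rmorphB rmorphM map_mxB map_mxM. Qed.

Lemma Delta_actN : X N.-1.+1 = 0.
Proof. by rewrite /X vDeltaN rmorph0 map_mx0. Qed.

Lemma Delta_act_ge0 k i j : (k <= N.-1)%N -> 0 <= X k i j.
Proof.
move=> kN; rewrite mxE ler0z.
exact: (zm_ge0 M (Ordinal (kN : (k < N.-1.+1)%N))).
Qed.

Lemma Delta_act_eigen a (u : 'cV[R]_n) k :
  X 1 *m u = a *: u -> X k *m u = cheb a k *: u.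
Proof.
move=> Au; suff: X k *m u = cheb a k *: u /\ X k.+1 *m u = cheb a k.+1 *: u by case.
elim: k => [|k [IH0 IH1]].
  by rewrite Delta_act0 mul1mx cheb0 scale1r cheb1.
split=> //; rewrite Delta_actSS mulmxBl -mulmxA IH1 IH0 -scalemxAr Au scalerA.
by rewrite -scalerBl chebSS mulrC.
Qed.

(** The sum telescopes through the common recurrence of [cheb a] and [X]. *)
Lemma Christoffel_Darboux a p :
  X 1 *m (\sum_(k < p.+1) cheb a k *: X k) - a *: (\sum_(k < p.+1) cheb a k *: X k) =
  cheb a p *: X p.+1 - cheb a p.+1 *: X p.
Proof.
elim: p => [|p IHp].
  by rewrite big_ord1 Delta_act0 cheb0 cheb1 !scale1r mulmx1.
rewrite big_ord_recr /= mulmxDr scalerDr opprD addrACA IHp -scalemxAr.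
have -> : X 1 *m X p.+1 = X p.+2 + X p by rewrite Delta_actSS subrK.
by apply/matrixP => i j; rewrite chebSS !mxE; ring.
Qed.

Lemma nonneg_eigenvector_exists lam (u : 'cV[R]_n) :
  u != 0 -> X 1 *m u = lam *: u -> (forall k, (k <= N.-1)%N -> 0 < cheb lam k) ->
  exists w : 'cV[R]_n,
    [/\ w != 0, forall i, 0 <= w i 0 & X 1 *m w = lam *: w].
Proof.
move=> u0 Au cheb_gt0.
(* The defining relation of the ring acts by zero on the nonzero [u], so [lam] is a root of it. *)
have chebN0 : cheb lam N.-1.+1 = 0.
  have /esym/eqP := Delta_act_eigen N.-1.+1 Au.
  by rewrite Delta_actN mul0mx scaler_eq0 (negPf u0) orbF => /eqP.
have /matrix0Pn[i0 _] := u0.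
pose E := \sum_(k < N.-1.+1) cheb lam k *: X k.
have E_ge0 (k : 'I_N.-1.+1) i j : 0 <= (cheb lam k *: X k) i j.
  by rewrite mxE mulr_ge0 ?Delta_act_ge0 ?ltW ?cheb_gt0 // -ltnS.
exists (col i0 E); split=> [|i|].
(* The diagonal entry is a sum of nonnegative terms, and the term k = 0, from the identity matrix,
   is 1. *)
- apply/eqP => /colP/(_ i0)/eqP; rewrite !mxE summxE psumr_eq0 //.
  move/allP/(_ ord0 (mem_index_enum _)).
  by rewrite /= mxE Delta_act0 cheb0 mxE eqxx mulr1 oner_eq0.
- by rewrite !mxE summxE sumr_ge0.
- rewrite colE mulmxA -/E scalemxAl; congr (_ *m _); apply/eqP.
  by rewrite -subr_eq0 Christoffel_Darboux Delta_actN chebN0 scaler0 scale0r subrr.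
Qed.

Lemma sqr_eigenspace_of_Delta2 lam (u v : 'cV[R]_n) :
  u != 0 -> X 1 *m u = lam *: u ->
  ((2 <= N.-1)%N -> X 2 *m v = cheb lam 2 *: v) ->
  X 1 *m (X 1 *m v) = lam ^+ 2 *: v.
Proof.
move=> u0 Au X2v.
have cheb2 : cheb lam 2 = lam ^+ 2 - 1 by rewrite chebSS cheb0 cheb1 expr2.
have X2 (w : 'cV[R]_n) : X 2 *m w = X 1 *m (X 1 *m w) - w.
  by rewrite Delta_actSS mulmxBl Delta_act0 mul1mx mulmxA.
suff : X 2 *m v = cheb lam 2 *: v.
  by rewrite X2 cheb2 scalerBl scale1r => /addIr.
(* If [N.-1] is 1, then [X 2] and [cheb lam 2] are both 0. If it is 0, then [X 1] and [lam] vanish,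
   and both sides equal -v. *)
have [N2|N2] := leqP 2 N.-1; first exact: X2v.
have act0 : X N.-1.+1 = 0 := Delta_actN.
have eig0 k : X k = 0 -> cheb lam k = 0.
  move=> Xk; have /esym/eqP := Delta_act_eigen k Au.
  by rewrite Xk mul0mx scaler_eq0 (negPf u0) orbF => /eqP.
have [N1|N1] : N.-1 = 1%N \/ N.-1 = 0%N by lia.
  by rewrite N1 in act0; rewrite eig0 // act0 mul0mx scale0r.
rewrite N1 in act0; have := eig0 _ act0; rewrite cheb1 => lam0.
by rewrite X2 act0 mul0mx cheb2 lam0 expr0n /= !sub0r scaleN1r.
Qed.

End VerlindeModule.

(** The components are (a v + A v) / 2a and (a v - A v) / 2a. *)
Lemma sqr_eigenspace (R : fieldType) n (A : 'M[R]_n) a (v : 'cV[R]_n) :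
  a *+ 2 != 0 -> A *m (A *m v) = a ^+ 2 *: v ->
  exists vp vm : 'cV[R]_n,
    [/\ v = vp + vm, A *m vp = a *: vp & A *m vm = - a *: vm].
Proof.
move=> a0 AAv; exists ((a *+ 2)^-1 *: (a *: v + A *m v)), ((a *+ 2)^-1 *: (a *: v - A *m v)).
split; rewrite -?scalemxAr ?mulmxDr ?mulmxN -?scalemxAr ?AAv.
- rewrite -scalerDr addrACA subrr addr0 -mulr2n scalerMnl scalerA mulVf //.
  by rewrite scale1r.
- rewrite [RHS]scalerA [a * _]mulrC -[RHS]scalerA; congr (_ *: _).
  by rewrite scalerDr scalerA addrC expr2.
- rewrite [RHS]scalerA [- a * _]mulrC -[RHS]scalerA; congr (_ *: _).
  by rewrite scaleNr scalerBr scalerA opprB expr2.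
Qed.

(** * The real adjacency matrix and its sign symmetry *)

Section ADEGraph.
Variables (R : realType) (G : dynkin).
Local Notation A := (map_mx intr (adjacency_mx G) : 'M[R]_(rank G)).

Lemma adjacency_ge0 i j : 0 <= A i j.
Proof. by rewrite !mxE; case: adjacent. Qed.

Lemma adjacency_irreducible (hG : is_ADE G) i j : connect [rel i j | 0 < A i j] i j.
Proof.
rewrite (eq_connect (e' := @adjacent G)) ?adjacent_connect // => k l /=.
by rewrite !mxE; case: adjacent; rewrite ?ltr01 ?ltxx.
Qed.

(** Edges join opposite colours, so this diagonal sign change conjugates A to -A and exchanges the
    eigenspaces of a and -a. *)
Definition flip (v : 'cV[R]_(rank G)) : 'cV[R]_(rank G) :=
  \col_i ((-1) ^+ colour i * v i 0).

Lemma flipK : involutive flip.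
Proof. by move=> v; apply/colP => i; rewrite !mxE signrMK. Qed.

Lemma flip_eigen a v : A *m v = a *: v -> A *m flip v = - a *: flip v.
Proof.
move=> /colP Av; apply/colP => i; rewrite !mxE mulNr mulrCA -mulrN.
have := Av i; rewrite !mxE => <-; rewrite mulrN -mulNr mulr_sumr.
apply: eq_bigr => j _; rewrite !mxE.
have [/adjacent_colour ->|_] := boolP (adjacent i j); last by rewrite !mul0r mulr0.
by case: colour; rewrite /=; ring.
Qed.

Lemma flip_neq0 v : v != 0 -> flip v != 0.
Proof.
apply: contra_neq => fv; rewrite -[v]flipK fv.
by apply/colP => i; rewrite !mxE mulr0.
Qed.

Lemma flipZ c v : flip (c *: v) = c *: flip v.
Proof. by apply/colP => i; rewrite !mxE mulrCA. Qed.

End ADEGraph.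

(** * Identification of the fixed points with the span of the two eigenvectors *)

Theorem theorem5p1 (R : realType) (G : dynkin) (hG : is_ADE G)
    (h : nat) (hh : is_coxeter_number G h)
    (M : ZplusModule (verlinde h.-1) (rank G))
    (hM : M (vDelta h.-1 1) = adjacency_mx G)
    (FP : FPdim (fusion_subring (verlinde_even h.-1)) R)
    (P : {vspace 'cV[R]_(rank G)}) (hP : is_coxeter_plane h P) :
  forall v : 'cV[R]_(rank G),
    fixed_point (scalar_ext_action FP (restrict_module (verlinde_even h.-1) M)) v
    <-> v \in P.
Proof.
have [up [um [[up0]]]] := hP.
rewrite adjacency_cartan; set lam := 2 * cos _ => Aup [um0 Aum] -> {P hP} v.
pose X := Delta_act R M.
pose A : 'M[R]_(rank G) := map_mx intr (adjacency_mx G).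
have X1 : X 1%N = A by rewrite /X /Delta_act hM.
rewrite -/A -X1 in Aup Aum.
have lam_neq0 : (h <= 1)%N -> lam != 0.
  rewrite /lam; case: (h) => [|[|//]] _.
    (* pi / 0 = 0 *)
    by rewrite invr0 mulr0 cos0 mulr1 pnatr_eq0.
  by rewrite divr1 cospi mulrN1 oppr_eq0 pnatr_eq0.
have X1_eq0 : h.-1.-1 = 0%N -> X 1%N = 0.
  by move=> m0; have := Delta_actN R M; rewrite m0.
(* For [h <= 1] the ring is Z[x]/(x), so A = 0, while [lam] would be 2 or -2. *)
have h2 : (1 < h)%N.
  rewrite ltnNge; apply/negP => h1; move: Aup; rewrite X1_eq0 ?mul0mx; last by lia.
  by move/esym/eqP; rewrite scaler_eq0 (negPf up0) orbF (negPf (lam_neq0 h1)).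
have cheb_gt0 k : (k <= h.-1.-1)%N -> 0 < cheb lam k.
  by move=> kh; apply: cheb_cos_gt0; lia.
pose I := fr_idx (fusion_subring (verlinde_even h.-1)).
pose e (i : I) := cheb lam (val i : 'I_h.-1.-1.+1).
have actE (i : I) : map_mx intr (restrict_module (verlinde_even h.-1) M (fr_b _ i)) =
  X (val i : 'I_h.-1.-1.+1) by [].
have FPe i : FP (fr_b _ i) = e i.
  apply: (positive_character_unique (FP_positive_character FP)) i.
  split=> [i|]; first by apply: cheb_gt0; rewrite -ltnS ltn_ord.
  apply: (eigenvector_character (M := restrict_module _ M) up0) => i.
  by rewrite actE; exact: Delta_act_eigen.
rewrite fixed_pointP.
split=> [fix_v|].
  have AAv : X 1%N *m (X 1%N *m v) = lam ^+ 2 *: v.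
    apply: (sqr_eigenspace_of_Delta2 up0 Aup) => hN.
    (* Among the fixed-point equations, the one for Delta_2 = x^2 - 1 already gives A^2 v = lam^2
       v. *)
    have i2 : (Ordinal (hN : 2 < h.-1.-1.+1)%N) \in even_idx h.-1 by rewrite inE.
    by have := fix_v (exist (fun i => i \in verlinde_even h.-1) _ i2); rewrite FPe actE.
  have [w [w0 w_ge0 Aw]] := nonneg_eigenvector_exists up0 Aup cheb_gt0.
  rewrite -/(X 1%N) X1 in Aw; rewrite X1 in Aup Aum AAv.
  have simple := nonneg_eigenvalue_simple (@adjacency_ge0 R G)
    (@adjacency_irreducible R G hG) w0 w_ge0 Aw.
  (* [flip] carries the eigenspace of [- lam] to that of [lam], where simplicity is known. *)
  have simple_opp x : A *m x = - lam *: x -> exists c, x = c *: um.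
    move=> /flip_eigen; rewrite opprK => Ax.
    have := flip_eigen Aum; rewrite opprK => Afum.
    have [c xE] := simple _ _ (flip_neq0 um0) Afum Ax.
    by exists c; rewrite -[x]flipK xE flipZ flipK.
  have mem_up : up \in <<[:: up; um]>>%VS by rewrite memv_span ?mem_head.
  have mem_um : um \in <<[:: up; um]>>%VS by rewrite memv_span // !inE eqxx orbT.
  have [lam0|lam0] := eqVneq lam 0; last first.
    have lam20 : lam *+ 2 != 0 by rewrite mulrn_eq0.
    have [vp [vm [-> Avp Avm]]] := sqr_eigenspace lam20 AAv.
    have [c ->] := simple _ _ up0 Aup Avp; have [c' ->] := simple_opp _ Avm.
    by rewrite memvD ?memvZ.
  (* This is the degenerate case [lam = 0]: positivity of [cheb lam 1 = lam] would fail if Delta_1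
     were a basis element. Hence A = 0, and simplicity makes V the line of [up]. *)
  have m0 : h.-1.-1 = 0%N.
    case: (posnP h.-1.-1) => // m_gt0.
    by have := cheb_gt0 _ m_gt0; rewrite cheb1 lam0 ltxx.
  have Av : A *m v = lam *: v by rewrite -X1 X1_eq0 // mul0mx lam0 scale0r.
  by have [c ->] := simple _ _ up0 Aup Av; rewrite memvZ.
rewrite span_cons span_seq1 => /memv_addP[_ /vlineP[c ->] [_ /vlineP[c' ->] ->]] i.
rewrite FPe actE mulmxDr -!scalemxAr (Delta_act_eigen _ Aup) (Delta_act_eigen _ Aum).
have /negPf odd_i : ~~ odd (val i : 'I_h.-1.-1.+1) by have := valP i; rewrite inE.
(* An even-indexed [Delta] takes the same value at [lam] and [- lam], so it scales both eigenvectors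
   alike. *)
by rewrite chebN -signr_odd odd_i mul1r -/(e i) scalerDr !scalerA ![e i * _]mulrC.
Qed.
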